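(* Let $$Q_4=\begin{pmatrix}1&0&1&0\\1&0&0&0\\0&0&0&1\\1&1&0&0\end{pmatrix}.$$ Then $\operatorname{sat}(n,Q_4)=O(1)$ as $n\to\infty$.
   Context: All matrices are 0-1 matrices. A matrix $M$ contains a pattern $P$ if some submatrix of $M$ (obtained by deleting rows and columns) can be turned into $P$ by changing some number (possibly zero) of its ones to zeroes. The weight is the number of $1$ entries. $M$ is $P$-saturated if $M$ does not contain $P$, but changing any $0$ entry of $M$ to a $1$ yields a matrix containing $P$. $\operatorname{sat}(n,P)$ is the minimum weight of an $n\times n$ $P$-saturated matrix. *)

(* Defs.v *)
From mathcomp Require Import all_boot matrix.

Set Implicit Arguments.
Unset Strict Implicit.
Unset Printing Implicit Defensive.

(* A 0-1 matrix is a boolean matrix, true standing for 1. *)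

Definition increasing k n (f : 'I_k -> 'I_n) : bool :=
  [forall a : 'I_k, forall b : 'I_k, (a < b) ==> (f a < f b)].

(* Deleting rows and columns of M leaves mxsub f g M, where the increasing
   maps f and g enumerate the rows and columns that are kept. *)
Definition contains m n k l (M : 'M[bool]_(m, n)) (P : 'M[bool]_(k, l)) : bool :=
  [exists f : {ffun 'I_k -> 'I_m}, exists g : {ffun 'I_l -> 'I_n},
    [&& increasing f, increasing g &
        [forall i, forall j, P i j ==> mxsub f g M i j]]].

Definition weight m n (M : 'M[bool]_(m, n)) : nat :=
  #|[set p : 'I_m * 'I_n | M p.1 p.2]|.

Definition set_one m n (M : 'M[bool]_(m, n)) (i : 'I_m) (j : 'I_n) :
    'M[bool]_(m, n) :=
  \matrix_(a, b) (((a == i) && (b == j)) || M a b).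

Definition saturated m n k l (P : 'M[bool]_(k, l)) (M : 'M[bool]_(m, n)) : bool :=
  ~~ contains M P &&
  [forall i, forall j, ~~ M i j ==> contains (set_one M i j) P].

(* No n x n matrix has weight more than n * n, so the default value n * n does
   not affect the minimum as soon as some n x n matrix is P-saturated; see
   sat_attained and sat_lower_bound. *)
Definition sat k l (n : nat) (P : 'M[bool]_(k, l)) : nat :=
  \big[minn/n * n]_(M : 'M[bool]_n | saturated P M) weight M.

Lemma weight_le m n (M : 'M[bool]_(m, n)) : weight M <= m * n.
Proof. by rewrite (leq_trans (max_card _)) // card_prod !card_ord. Qed.

Lemma sat_lower_bound k l n (P : 'M[bool]_(k, l)) (M : 'M[bool]_n) :
  saturated P M -> sat n P <= weight M.
Proof.
rewrite /sat => sM; have := mem_index_enum M.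
elim: (index_enum _) => //= N s IH; rewrite inE big_cons.
case/predU1P=> [<-|Ms]; first by rewrite sM geq_minl.
by case: ifP => _; rewrite ?geq_min IH ?orbT.
Qed.

Lemma sat_attained k l n (P : 'M[bool]_(k, l)) (M0 : 'M[bool]_n) :
  saturated P M0 -> exists2 M : 'M[bool]_n, saturated P M & weight M = sat n P.
Proof.
move=> sM0; have := sat_lower_bound sM0; rewrite /sat.
elim/big_ind: _ => [le0|x y IHx IHy|M sM _]; last by exists M.
  by exists M0 => //; apply/eqP; rewrite eqn_leq weight_le.
by case: (leqP x y) => _; [apply: IHx | apply: IHy].
Qed.

Definition Q4 : 'M[bool]_4 :=
  \matrix_(i, j)
    (nth 0 (nth [::] [:: [:: 1; 0; 1; 0];
                         [:: 1; 0; 0; 0];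
                         [:: 0; 0; 0; 1];
                         [:: 1; 1; 0; 0]] i) j == 1).

(* Main.v *)
Require Import Defs.
From mathcomp Require Import all_boot matrix zify.

Set Implicit Arguments.
Unset Strict Implicit.
Unset Printing Implicit Defensive.

(** Bounded saturation follows from one finite witness: a matrix W that avoids
    the pattern P and has an empty row r and an empty column c such that writing
    a 1 anywhere in row r or column c creates P.

    Given such a W, replace r by many copies of itself, and c likewise, until
    the matrix is n x n.  When P has no empty row and no empty column, empty
    lines are of no use to an occurrence of P, so the enlarged matrix still
    avoids P ([blow_up_avoids]).  A 1 written in any copy of r or c creates P,
    since deleting the other copies gives back W ([blow_up_set_one]).  Complete
    the enlarged matrix to a P-saturated one by adding 1s as long as P does not
    appear ([saturated_completion]): no 1 can ever be added in a copy of r or c,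
    so all the 1s stay in the other rows and columns, whose number does not
    depend on n ([sat_expandable]).

    For Q4 there is a witness with 8 rows and 7 columns, in which row 3 and
    column 3, counting from 0, are empty:
<<
           0 1 2 3 4 5 6
        0  . 1 1 . 1 . .
        1  1 . 1 . . . .
        2  1 . 1 . . 1 .
        3  . . . . . . .
        4  1 1 1 . . . 1
        5  . . 1 . 1 . .
        6  . 1 1 . . . .
        7  1 . 1 . . . .
>>
    Entries of Q4 are also named by row and column, counting from 0.

    - A new 1 in row 3 and in one of the columns 3 to 6 acts as the lone 1 at
      (2, 3) of Q4: the other 1s of Q4 are found in rows 1, 2, 4 and columns
      0, 1, 2.
    - A new 1 in row 3 and in column 0, 1 or 2 acts as the lone 1 at (1, 0).
      The other 1s of Q4 are found in rows 2, 4, 7 and columns 0, 2, 5, 6, in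
      rows 0, 4, 6 and columns 1, 2, 4, 6, and in rows 2, 4, 5 and columns
      2, 4, 5, 6, respectively.
    - A new 1 in column 3 above row 3 acts as the 1 at (0, 2); for row 0 the
      other rows are 4, 5, 6 and the other columns 1, 2, 4, for rows 1 and 2 the
      other rows are 4, 5, 7 and the other columns 0, 2, 4.
    - A new 1 in column 3 below row 3 acts as the 1 at (3, 1), with the other
      1s in rows 0, 1, 2 and columns 2, 4, 5.

    The witness avoids Q4: the 1 at (2, 3) of Q4 has three columns on its left
    and two rows above it, so it can only be matched to (2, 5), (4, 6) or
    (5, 4).  In the first two cases the first two rows of Q4 are matched above
    row 3.  If row 0 is among them, column 0 of Q4 goes to column 2 and column 2
    of Q4 to column 4, so that column 1 of Q4 would fall on the empty column 3.
    Otherwise they are rows 1 and 2, the columns 0, 1, 2 of Q4 are matched to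
    themselves, and no row below row 4 has a 1 in both columns 0 and 1.  The
    same columns are forced in the case of (5, 4), and neither row 6 nor row 7
    has a 1 in both columns 0 and 1. *)

(** * Containment and saturation *)

Lemma increasingP k n (f : 'I_k -> 'I_n) :
  reflect {homo f : a b / a < b} (increasing f).
Proof.
apply: (iffP forallP) => [incf a b lt_ab | incf a].
  by have /forallP/(_ b)/implyP := incf a; apply.
by apply/forallP => b; apply/implyP; apply: incf.
Qed.

Lemma containsP m n k l (M : 'M[bool]_(m, n)) (P : 'M[bool]_(k, l)) :
  reflect (exists (f : 'I_k -> 'I_m) (g : 'I_l -> 'I_n),
             [/\ {homo f : a b / a < b}, {homo g : a b / a < b}
               & forall i j, P i j -> M (f i) (g j)])
          (contains M P).
Proof.
apply: (iffP existsP) => [[f /existsP[g /and3P[incf incg sPM]]] | [f [g]]].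
  exists f, g; split; [exact/increasingP | exact/increasingP | move=> i j Pij].
  by have /forallP/(_ j)/implyP/(_ Pij) := forallP sPM i; rewrite mxE.
case=> incf incg sPM; exists (finfun f); apply/existsP; exists (finfun g).
apply/and3P; split.
- by apply/increasingP => a b; rewrite !ffunE; apply: incf.
- by apply/increasingP => a b; rewrite !ffunE; apply: incg.
- apply/forallP => i; apply/forallP => j; apply/implyP => Pij.
  by rewrite !(mxE, ffunE); apply: sPM.
Qed.

Lemma contains_mono m n k l (M N : 'M[bool]_(m, n)) (P : 'M[bool]_(k, l)) :
  (forall i j, M i j -> N i j) -> contains M P -> contains N P.
Proof.
move=> sMN /containsP[f [g [incf incg sPM]]]; apply/containsP.
by exists f, g; split=> // i j /sPM/sMN.
Qed.

Lemma weight_set_one m n (M : 'M[bool]_(m, n)) i j :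
  ~~ M i j -> weight M < weight (set_one M i j).
Proof.
move=> Mij0; apply/proper_card/properP; split.
  by apply/subsetP => p; rewrite !inE mxE => ->; rewrite orbT.
by exists (i, j); rewrite !inE ?mxE ?eqxx //=.
Qed.

(** An avoiding matrix of maximal weight among those above [M] is saturated. *)
Lemma saturated_completion m n k l (P : 'M[bool]_(k, l)) (M : 'M[bool]_(m, n)) :
  ~~ contains M P ->
  exists2 N, saturated P N & forall i j, M i j -> N i j.
Proof.
move=> avM.
pose adm (N : 'M[bool]_(m, n)) :=
  ~~ contains N P && [forall i, forall j, M i j ==> N i j].
have admM : adm M.
  by rewrite /adm avM; apply/forallP => i; apply/forallP => j; apply/implyP.
case: (@arg_maxnP _ M adm (@weight m n) admM) => N /andP[avN sMN] maxN.
have {}sMN i j : M i j -> N i j.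
  by move=> Mij; have /forallP/(_ j)/implyP/(_ Mij) := forallP sMN i.
exists N => //; rewrite /saturated avN; apply/forallP => i; apply/forallP => j.
apply/implyP => Nij0; apply: contraT => avN1.
have /maxN : adm (set_one N i j).
  rewrite /adm avN1; apply/forallP => i1; apply/forallP => j1.
  by apply/implyP => /sMN Nij; rewrite mxE Nij orbT.
by move=> /= le_N; have := weight_set_one Nij0; rewrite ltnNge le_N.
Qed.

(** * Repeating one index *)

Lemma collapse_subproof a (r : 'I_a) n (i : 'I_n) :
  minn i (maxn r (i - (n - a))) < a.
Proof. have := ltn_ord r; have := ltn_ord i; lia. Qed.

(** The nondecreasing map from ['I_n] onto ['I_a], for [a <= n], whose fibre over
    [r] has [n - a + 1] elements while its other fibres are singletons. *)
Definition collapse a (r : 'I_a) n (i : 'I_n) : 'I_a :=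
  Ordinal (collapse_subproof r i).

Lemma collapse_homo a (r : 'I_a) n (i j : 'I_n) :
  i < j -> collapse r i < collapse r j \/
           collapse r i = r /\ collapse r j = r.
Proof.
move=> lt_ij; have := ltn_ord j; have := ltn_ord r.
have [eq_c|] := eqVneq (collapse r i) (collapse r j).
  move/(congr1 val): eq_c => /=.
  by right; split; apply/val_inj => /=; lia.
by rewrite -(inj_eq val_inj) /=; left; lia.
Qed.

Lemma collapse_inj a (r : 'I_a) n (i j : 'I_n) :
  collapse r i = collapse r j -> collapse r i != r -> i = j.
Proof.
move=> eq_c ne_r; apply/val_inj => /=.
by have [/(collapse_homo r)|/(collapse_homo r)|//] := ltngtP i j;
   case=> [|[? ?]]; rewrite ?eq_c ?ltnn //; move: ne_r; rewrite eq_c => /eqP.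
Qed.

(** Choosing one representative in each fibre embeds ['I_a] into ['I_n]
    monotonically; as the representative of [r] is free, the embedding can be
    made to pass through any prescribed [i]. *)
Lemma collapse_section a (r : 'I_a) n (i : 'I_n) : a <= n ->
  exists s : 'I_a -> 'I_n,
    [/\ {homo s : x y / x < y}, forall k, collapse r (s k) = k
     & s (collapse r i) = i].
Proof.
move=> le_an; have ltr := ltn_ord r; have lti := ltn_ord i.
(* The image of r is i clamped to the fibre of r: i itself if it lies there. *)
pose v (k : 'I_a) : nat :=
  if k < r then nat_of_ord k
  else if k == r then maxn r (minn i (r + (n - a))) else k + (n - a).
have ltv k : v k < n.
  by have := ltn_ord k; rewrite /v -(inj_eq val_inj) /=; do 2?case: ifP; lia.
exists (fun k => Ordinal (ltv k)); split=> [x y lt_xy | k |].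
- by have := ltn_ord y; rewrite /= /v -!(inj_eq val_inj) /=; do 4?case: ifP; lia.
- apply/val_inj; have := ltn_ord k.
  by rewrite /= /v -(inj_eq val_inj) /=; do 2?case: ifP; lia.
- by apply/val_inj; rewrite /= /v -(inj_eq val_inj) /=; do 2?case: ifP; lia.
Qed.

(** * Bounded saturation from an expandable row and column *)

Section Expandable.

Variables (k l a b : nat) (P : 'M[bool]_(k, l)) (W : 'M[bool]_(a, b)).
Variables (r : 'I_a) (c : 'I_b).
Hypothesis P_rows : forall i, exists j, P i j.
Hypothesis P_cols : forall j, exists i, P i j.
Hypothesis W_row : forall j, ~~ W r j.
Hypothesis W_col : forall i, ~~ W i c.
Hypothesis W_avoids : ~~ contains W P.

Definition blow_up m n : 'M[bool]_(m, n) :=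
  \matrix_(i, j) W (collapse r i) (collapse c j).

(** Two rows of an occurrence with the same image under [collapse] would both be
    copies of the empty row [r], although every row of [P] contains a 1; so an
    occurrence in the enlarged matrix collapses to an occurrence in [W]. *)
Lemma blow_up_avoids m n : ~~ contains (blow_up m n) P.
Proof.
apply: contra W_avoids => /containsP[f [g [incf incg sPM]]].
have {}sPM i j : P i j -> W (collapse r (f i)) (collapse c (g j)).
  by move/sPM; rewrite mxE.
apply/containsP; exists (fun i => collapse r (f i)), (fun j => collapse c (g j)).
split=> // [i1 i2 /incf/(collapse_homo r) [//|[eq_r _]] |
            j1 j2 /incg/(collapse_homo c) [//|[eq_c _]]].
  by have [j /sPM] := P_rows i1; rewrite eq_r (negPf (W_row _)).
by have [i /sPM] := P_cols j1; rewrite eq_c (negPf (W_col _)).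
Qed.

(** The sections through [i] and [j] place a copy of [W] in the enlarged matrix
    so that the modified entry of [W] lands on [(i, j)]. *)
Lemma blow_up_set_one m n (i : 'I_m) (j : 'I_n) : a <= m -> b <= n ->
  contains (set_one W (collapse r i) (collapse c j)) P ->
  contains (set_one (blow_up m n) i j) P.
Proof.
move=> le_am le_bn /containsP[f [g [incf incg sPW]]].
have [s [incs sK s_i]] := collapse_section r i le_am.
have [t [inct tK t_j]] := collapse_section c j le_bn.
apply/containsP; exists (s \o f), (t \o g).
split=> [x y /incf/incs //|x y /incg/inct //|x y].
move=> /sPW; rewrite !mxE /= sK tK => /orP[/andP[/eqP-> /eqP->] | ->].
  by rewrite s_i t_j !eqxx.
by rewrite orbT.
Qed.

Hypothesis expandable :
  forall i j, (i == r) || (j == c) -> contains (set_one W i j) P.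

(** In a saturated completion of the enlarged matrix, all 1s lie outside the
    copies of [r] and [c], where [collapse] is injective. *)
Lemma sat_expandable n : a <= n -> b <= n -> sat n P <= a.-1 * b.-1.
Proof.
move=> le_an le_bn.
have [M satM sWM] := saturated_completion (blow_up_avoids n n).
apply: leq_trans (sat_lower_bound satM) _.
have M_cross i j : M i j -> (collapse r i != r) && (collapse c j != c).
  move=> Mij; rewrite -negb_or; apply/negP => /expandable.
  move/(blow_up_set_one le_an le_bn) => occ.
  have /andP[/negP avM _] := satM; apply: avM; apply: contains_mono occ => x y.
  by rewrite mxE => /orP[/andP[/eqP-> /eqP->] | /sWM].
pose phi (p : 'I_n * 'I_n) := (collapse r p.1, collapse c p.2).
have inj_phi : {in [set p : 'I_n * 'I_n | M p.1 p.2] &, injective phi}.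
  move=> [i j] [i' j']; rewrite !inE /= => /M_cross/andP[nr nc] _ eq_phi.
  congr (_, _); first exact: collapse_inj (congr1 fst eq_phi) nr.
  exact: collapse_inj (congr1 snd eq_phi) nc.
rewrite /weight -(card_in_imset inj_phi).
apply: (@leq_trans #|setX [set~ r] [set~ c]|).
  2: by rewrite cardsX !cardsC1 !card_ord.
apply/subset_leq_card/subsetP => p /imsetP[[i j]]; rewrite inE => Mij ->.
by rewrite !inE; apply: M_cross.
Qed.

End Expandable.

(** * Deciding containment of the pattern *)

(** Occurrences are enumerated over natural numbers because containment itself,
    which quantifies over finite functions, does not reduce.  The rows are
    [x0 < x1 < x2 < x3] and the columns [y0 < y1 < y2 < y3]; each entry is tested
    as soon as its position is known. *)
Definition Q4_occurs (m n : nat) (w : nat -> nat -> bool) : bool :=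
  let range lo hi := iota lo (hi - lo) in
  has (fun x0 => has (fun x1 => has (fun x2 => has (fun x3 =>
  has (fun y0 => [&& w x0 y0, w x1 y0, w x3 y0 &
    has (fun y1 => w x3 y1 &&
      has (fun y2 => w x0 y2 && has (w x2) (range y2.+1 n))
    (range y1.+1 n)) (range y0.+1 n)]) (range 0 n))
  (range x2.+1 m)) (range x1.+1 m)) (range x0.+1 m)) (range 0 m).

Lemma has_rangeP (lo hi : nat) (p : nat -> bool) :
  reflect (exists i, [/\ lo <= i, i < hi & p i]) (has p (iota lo (hi - lo))).
Proof.
apply: (iffP hasP) => [[i]|[i [le_i lt_i pi]]].
  by rewrite mem_iota => lt_i pi; exists i; split=> //; lia.
by exists i => //; rewrite mem_iota; lia.
Qed.

Lemma ord4P (p : 'I_4 -> Prop) :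
  p (inord 0) -> p (inord 1) -> p (inord 2) -> p (inord 3) -> forall i, p i.
Proof.
move=> p0 p1 p2 p3 i; rewrite -(inord_val i).
by case: i => [[|[|[|[|?]]]] ?].
Qed.

Lemma increasing4 n (s : seq nat) :
  size s = 4 -> sorted ltn s -> all (gtn n.+1) s ->
  {homo (fun i : 'I_4 => inord (nth 0 s i) : 'I_n.+1) : i j / i < j}.
Proof.
move=> sz_s s_lt s_ub i j lt_ij; have lt_s (h : 'I_4) : nth 0 s h < n.+1.
  by apply: (allP s_ub); rewrite mem_nth // sz_s.
rewrite !inordK //.
by apply: (sorted_ltn_nth ltn_trans); rewrite ?inE ?sz_s.
Qed.

Lemma contains_Q4 m n (w : nat -> nat -> bool) :
  contains (\matrix_(i < m.+1, j < n.+1) w i j) Q4 = Q4_occurs m.+1 n.+1 w.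
Proof.
apply/containsP/idP => [[f [g [incf incg occ]]] | ].
  have {}occ i j : Q4 i j -> w (f i) (g j) by move/occ; rewrite mxE.
  have Q x y : x < 4 -> y < 4 -> Q4 (inord x) (inord y) ->
    w (f (inord x)) (g (inord y)) by move=> _ _; apply: occ.
  have inc x y : x < y < 4 -> f (inord x) < f (inord y).
    by move=> h; apply: incf; rewrite !inordK; lia.
  have inc' x y : x < y < 4 -> g (inord x) < g (inord y).
    by move=> h; apply: incg; rewrite !inordK; lia.
  apply/has_rangeP; exists (f (inord 0)); split=> //.
  apply/has_rangeP; exists (f (inord 1)); split; rewrite ?inc //.
  apply/has_rangeP; exists (f (inord 2)); split; rewrite ?inc //.
  apply/has_rangeP; exists (f (inord 3)); split; rewrite ?inc //.
  apply/has_rangeP; exists (g (inord 0)); split=> //.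
  rewrite !Q ?mxE ?inordK //=.
  apply/has_rangeP; exists (g (inord 1)); split; rewrite ?inc' //.
  rewrite !Q ?mxE ?inordK //=.
  apply/has_rangeP; exists (g (inord 2)); split; rewrite ?inc' //.
  rewrite !Q ?mxE ?inordK //=.
  apply/has_rangeP; exists (g (inord 3)); split; rewrite ?inc' //.
  by rewrite !Q ?mxE ?inordK.
case/has_rangeP=> x0 [_ lt_x0 /has_rangeP[x1 [le_x1 lt_x1 /has_rangeP[x2 [le_x2 lt_x2]]]]].
case/has_rangeP=> x3 [le_x3 lt_x3 /has_rangeP[y0 [_ lt_y0 /and4P[w00 w10 w30]]]].
case/has_rangeP=> y1 [le_y1 lt_y1 /andP[w31 /has_rangeP[y2 [le_y2 lt_y2]]]].
case/andP=> w02 /has_rangeP[y3 [le_y3 lt_y3 w23]].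
exists (fun i => inord (nth 0 [:: x0; x1; x2; x3] i)).
exists (fun i => inord (nth 0 [:: y0; y1; y2; y3] i)).
split; [by apply: increasing4 => //=; lia | by apply: increasing4 => //=; lia |].
by do 2![elim/ord4P]; rewrite !mxE !inordK //= !inordK.
Qed.

(** * The witness *)

Definition witness_entry (i j : nat) : bool :=
  nth 0 (nth [::]
    [:: [:: 0; 1; 1; 0; 1; 0; 0];
        [:: 1; 0; 1; 0; 0; 0; 0];
        [:: 1; 0; 1; 0; 0; 1; 0];
        [:: 0; 0; 0; 0; 0; 0; 0];
        [:: 1; 1; 1; 0; 0; 0; 1];
        [:: 0; 0; 1; 0; 1; 0; 0];
        [:: 0; 1; 1; 0; 0; 0; 0];
        [:: 1; 0; 1; 0; 0; 0; 0]] i) j == 1.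

Definition witness : 'M[bool]_(8, 7) := \matrix_(i, j) witness_entry i j.

Lemma witness_avoids : ~~ contains witness Q4.
Proof. by rewrite contains_Q4; vm_compute. Qed.

Lemma witness_expandable (i : 'I_8) (j : 'I_7) :
  (i == inord 3) || (j == inord 3) -> contains (set_one witness i j) Q4.
Proof.
pose entry1 x y x' y' := (x' == x) && (y' == y) || witness_entry x' y'.
have -> : set_one witness i j = (\matrix_(x, y) entry1 i j x y)%R.
  by apply/matrixP => x y; rewrite !mxE.
rewrite contains_Q4 -!(inj_eq val_inj) /= !inordK // => cross.
have check : all (fun x => all (fun y =>
    (x != 3) && (y != 3) || Q4_occurs 8 7 (entry1 x y)) (iota 0 7)) (iota 0 8).
  by vm_compute.
have in_iota k (x : 'I_k) : val x \in iota 0 k by rewrite mem_iota ltn_ord.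
have /allP/(_ _ (in_iota _ j)) := allP check _ (in_iota _ i).
by rewrite -negb_or cross.
Qed.

Theorem proposition9p4 :
  exists C n0 : nat, forall n : nat, n0 <= n -> sat n Q4 <= C.
Proof.
exists (7 * 6), 8 => n le8n.
apply: (sat_expandable _ _ _ _ witness_avoids witness_expandable) => //.
- by elim/ord4P; [exists (inord 0) | exists (inord 0) | exists (inord 3)
                 | exists (inord 0)]; rewrite mxE !inordK.
- by elim/ord4P; [exists (inord 0) | exists (inord 3) | exists (inord 0)
                 | exists (inord 2)]; rewrite mxE !inordK.
- by move=> j; rewrite mxE inordK //; case: j => [[|[|[|[|[|[|[|?]]]]]]] ?].
- by move=> i; rewrite mxE inordK //; case: i => [[|[|[|[|[|[|[|[|?]]]]]]]] ?].
- exact: ltnW.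
Qed.
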